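(* Let $d',d''\in\mathbb{N}$. A relation $\mathbf X\subseteq\mathbb{N}^{d'}\times\mathbb{N}^{d''}$ is a PVASS section if and only if $\mathbf X=\mathrm{Rel}(\mathbf E)$ for some expression $\mathbf E$ (of input dimension $d'$ and output dimension $d''$).
   Context: $\mathbb{N}$ contains $0$. A priority vector addition system with states (PVASS) of dimension $d\in\mathbb{N}$ is a finite directed multigraph $\mathcal V=(Q,E)$ whose edges $e$ are labelled with a pair of a vector $f(e)\in\mathbb{Z}^d$ and a number $g(e)\in\{0,\dots,d\}$. Configurations are elements of $Q\times\mathbb{N}^d$. An edge $e$ from $p$ to $p'$ induces the relation $(q,\mathbf{x})\to_e(q',\mathbf{x}')$ iff $q=p$, $q'=p'$, $\mathbf{x}(j)=0$ for all $1\le j\le g(e)$, and $\mathbf{x}'=\mathbf{x}+f(e)$ (with $\mathbf{x},\mathbf{x}'\in\mathbb{N}^d$). Put $\to_{\mathcal V}=\bigcup_{e\in E}\to_e$, and let $\to_{\mathcal V}^{*}$ be its reflexive transitive closure. A VASS is a PVASS with $g(e)=0$ for all edges $e$. A relation $\mathbf X\subseteq\mathbb{N}^{d'}\times\mathbb{N}^{d''}$ is a PVASS section (resp. VASS section) if there exist a PVASS (resp. VASS) $\mathcal V$ of dimension $d\ge d',d''$, states $p,q$ and vectors $\mathbf b_s\in\mathbb{N}^{d-d'}$, $\mathbf b_t\in\mathbb{N}^{d-d''}$ with $\mathbf X=\{(\mathbf x,\mathbf y)\in\mathbb{N}^{d'}\times\mathbb{N}^{d''}\mid (p,(\mathbf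 b_s,\mathbf x))\to_{\mathcal V}^{*}(q,(\mathbf b_t,\mathbf y))\}$. Expressions: every expression $\mathbf E$ has an input dimension $in(\mathbf E)\in\mathbb{N}$ and an output dimension $out(\mathbf E)\in\mathbb{N}$ and defines a relation $\mathrm{Rel}(\mathbf E)\subseteq\mathbb{N}^{in(\mathbf E)}\times\mathbb{N}^{out(\mathbf E)}$. They are built inductively: (1) every VASS section $\mathbf Y\subseteq\mathbb{N}^{d'}\times\mathbb{N}^{d''}$ is an expression with dimensions $d',d''$ and $\mathrm{Rel}(\mathbf Y)=\mathbf Y$; (2) if $out(\mathbf E_1)=in(\mathbf E_2)$ then $\mathbf E_1\circ\mathbf E_2$ is an expression with dimensions $in(\mathbf E_1),out(\mathbf E_2)$ and $\mathrm{Rel}(\mathbf E_1\circ\mathbf E_2)=\mathrm{Rel}(\mathbf E_1)\circ\mathrm{Rel}(\mathbf E_2)$, where $\mathbf{R}_1\circ\mathbf{R}_2=\{(\mathbf v,\mathbf w)\mid\exists \mathbf x:(\mathbf v,\mathbf x)\in\mathbf R_1,(\mathbf x,\mathbf w)\in\mathbf R_2\}$; (3) if $\mathbf E_1,\mathbf E_2$ have the same input dimension and the same output dimension, then $\mathbf E_1\cup\mathbf E_2$ is an expression with these dimensions and $\mathrm{Rel}(\mathbf E_1\cup\mathbf E_2)=\mathrm{Rel}(\mathbf E_1)\cup\mathrm{Rel}(\mathbf E_2)$; (4) if $in(\mathbf E)=out(\mathbf E)=d'$ then $\mathbf E^{*}$ is an expression with dimensions $d',d'$, and $\mathrm{Rel}(\mathbf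 E^{*})$ is the reflexive transitive closure of $\mathrm{Rel}(\mathbf E)$ on $\mathbb{N}^{d'}$. *)

(* Defs.v *)
From Stdlib Require Import Relation_Operators.
From HB Require Import structures.
From mathcomp Require Import all_boot all_order all_algebra.
From mathcomp Require Import classical_sets.

Set Implicit Arguments.
Unset Strict Implicit.
Unset Printing Implicit Defensive.

Import GRing.Theory.

Local Open Scope classical_set_scope.
Local Open Scope ring_scope.

Definition vrel (m n : nat) := set ('rV[nat]_m * 'rV[nat]_n).

(* Edges form a type of their own, so that parallel edges, even with equal
   labels, are allowed. *)
Record pvass (d : nat) := PVASS {
  state : finType;
  edge : finType;
  src : edge -> state;
  tgt : edge -> state;
  effect : edge -> 'rV[int]_d;
  prio : edge -> 'I_d.+1
}.

Definition is_vass (d : nat) (V : pvass d) : Prop :=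
  forall e : edge V, prio e = ord0.

Definition config (d : nat) (V : pvass d) : Type := (state V * 'rV[nat]_d)%type.

(* Coordinates are numbered from 0: testing the first [prio e] coordinates for
   zero means testing those [j] with [j < prio e]. *)
Definition edge_step (d : nat) (V : pvass d) (e : edge V) (c c' : config V) :
    Prop :=
  [/\ c.1 = src e,
      c'.1 = tgt e,
      (forall j : 'I_d, (j < prio e)%N -> c.2 ord0 j = 0%N)
    & map_mx Posz c'.2 = map_mx Posz c.2 + effect e].

Definition step (d : nat) (V : pvass d) (c c' : config V) : Prop :=
  exists e : edge V, edge_step e c c'.

Definition reach (d : nat) (V : pvass d) : config V -> config V -> Prop :=
  clos_refl_trans (config V) (@step d V).

(* The vector (b, x) of N^d; the cast is along (d - m) + m = d. *)
Definition pad (m d : nat) (lemd : (m <= d)%N) (b : 'rV[nat]_(d - m))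
    (x : 'rV[nat]_m) : 'rV[nat]_d :=
  castmx (erefl 1%N, subnK lemd) (row_mx b x).

Definition section_of (d : nat) (V : pvass d) (m n : nat)
    (lemd : (m <= d)%N) (lend : (n <= d)%N) (p q : state V)
    (bs : 'rV[nat]_(d - m)) (bt : 'rV[nat]_(d - n)) : vrel m n :=
  [set xy | reach (p, pad lemd bs xy.1) (q, pad lend bt xy.2)].

Definition pvass_section (m n : nat) (X : vrel m n) : Prop :=
  exists (d : nat) (V : pvass d) (lemd : (m <= d)%N) (lend : (n <= d)%N)
         (p q : state V) (bs : 'rV[nat]_(d - m)) (bt : 'rV[nat]_(d - n)),
    X = section_of lemd lend p q bs bt.

Definition vass_section (m n : nat) (X : vrel m n) : Prop :=
  exists (d : nat) (V : pvass d) (lemd : (m <= d)%N) (lend : (n <= d)%N)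
         (p q : state V) (bs : 'rV[nat]_(d - m)) (bt : 'rV[nat]_(d - n)),
    is_vass V /\ X = section_of lemd lend p q bs bt.

(* The indices are the input and output dimensions. *)
Inductive expr : nat -> nat -> Type :=
| ESection (m n : nat) (Y : vrel m n) : vass_section Y -> expr m n
| EComp (m n k : nat) : expr m n -> expr n k -> expr m k
| EUnion (m n : nat) : expr m n -> expr m n -> expr m n
| EStar (m : nat) : expr m m -> expr m m.

Definition vrel_star (m : nat) (R : vrel m m) : vrel m m :=
  [set xy | clos_refl_trans 'rV[nat]_m (fun x y => R (x, y)) xy.1 xy.2].

(* [B \; A] on sets of pairs relates x to y when A (x, z) and B (z, y) for some
   z: the relation applied first is the right operand. *)
Fixpoint Rel (m n : nat) (E : expr m n) : vrel m n :=
  match E in expr m n return vrel m n with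
  | ESection _ _ Y _ => Y
  | EComp _ _ _ E1 E2 => (Rel E2 \; Rel E1)%relation
  | EUnion _ _ E1 E2 => Rel E1 `|` Rel E2
  | EStar _ E1 => vrel_star (Rel E1)
  end.

(* Main.v *)
Require Import Defs.
From Stdlib Require Import Relation_Operators Operators_Properties.
From mathcomp Require Import all_boot all_order all_algebra.
From mathcomp Require Import boolp classical_sets.

(** A PVASS step is a zero test followed by a VASS step. The test of the first
    k of d counters is the VASS section {((0,z),z)}, which drops these counters,
    composed with its converse, so every one-edge relation on N^d is defined by
    an expression, and Kleene's algorithm on the state graph yields the
    reachability relation between any two states.

    Conversely, after lifting all the PVASS to a common dimension d (new counters
    are put in front and stay 0), a relation on N^m is seen as a relation between
    vectors of N^d whose first d - m counters vanish, which a priority test can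
    check. Composition, union and star are then reachability in finite graphs
    whose edges are replaced by PVASS, each edge leaving a node being guarded by
    the test attached to that node. *)

Set Implicit Arguments.
Unset Strict Implicit.
Unset Printing Implicit Defensive.

Import GRing.Theory.

Local Open Scope classical_set_scope.
Local Open Scope ring_scope.

(** * Vectors with leading zeros *)

Lemma vrel_ext m n (X Y : vrel m n) :
  (forall x y, X (x, y) <-> Y (x, y)) -> X = Y.
Proof. by move=> XY; apply/seteqP; split=> -[x y] /XY. Qed.

Lemma map_Posz_inj n : injective (@map_mx nat int Posz 1 n).
Proof.
by move=> x y /matrixP xy; apply/matrixP=> i j; have := xy i j; rewrite !mxE => -[].
Qed.

Lemma map_PoszD n (x y : 'rV[nat]_n) :
  map_mx Posz (x + y) = map_mx Posz x + map_mx Posz y.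
Proof. by apply/matrixP=> i j; rewrite !mxE PoszD. Qed.

Lemma pad_id d (b : 'rV[nat]_(d - d)) (x : 'rV[nat]_d) : pad (leqnn d) b x = x.
Proof.
apply/rowP=> j; rewrite /pad castmxE /= ord1.
have -> : cast_ord (esym (subnK (leqnn d))) j = rshift (d - d) j.
  by apply/val_inj; rewrite /= subnn.
by rewrite row_mxEr.
Qed.

Lemma pad_entry m d (lemd : (m <= d)%N) b x (j : 'I_d) (k : 'I_(d - m + m)) :
  j = k :> nat -> pad lemd b x ord0 j = row_mx b x ord0 k.
Proof.
move=> jk; rewrite /pad castmxE; congr (fun_of_matrix (row_mx b x) _ _); first exact: ord1.
exact: val_inj.
Qed.

Definition zeros d k (x : 'rV[nat]_d) :=
  forall j : 'I_d, (j < k)%N -> x ord0 j = 0%N.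

Lemma pad0_zeros m d (lemd : (m <= d)%N) (x : 'rV[nat]_m) :
  zeros (d - m) (pad lemd 0 x).
Proof.
move=> j ltj; rewrite (@pad_entry _ _ _ _ _ j (lshift m (Ordinal ltj))) //.
by rewrite row_mxEl mxE.
Qed.

(** With [pad0_zeros], this makes a zero test of the first [d - m] counters the exact criterion for
    a vector of N^d to encode one of N^m. *)
Lemma zeros_pad0 m d (lemd : (m <= d)%N) (x : 'rV[nat]_d) :
  zeros (d - m) x -> exists z, x = pad lemd 0 z.
Proof.
move=> zx; pose y := castmx (erefl 1%N, esym (subnK lemd)) x.
exists (rsubmx y); have {1}-> : x = castmx (erefl 1%N, subnK lemd) y.
  by rewrite /y castmx_comp castmx_id.
congr castmx; rewrite -{1}[y]hsubmxK; congr row_mx.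
by apply/rowP=> j; rewrite !mxE castmxE ord1 zx //= cast_ord_id.
Qed.

Lemma reach_step d (V : pvass d) (c1 c2 c3 : config V) :
  reach c1 c2 -> step c2 c3 -> reach c1 c3.
Proof. by move=> c12 c23; apply: rt_trans c12 (rt_step _ _ _ _ c23). Qed.

(** * Basic definable relations and finite unions *)

Definition definable m n (X : vrel m n) := exists E : expr m n, X = Rel E.

Lemma definable_vass m n (X : vrel m n) : vass_section X -> definable X.
Proof. by move=> VX; exists (ESection VX). Qed.

Lemma definable_comp m n k (X : vrel m n) (Y : vrel n k) :
  definable X -> definable Y -> definable (Y \; X)%relation.
Proof. by move=> [E ->] [F ->]; exists (EComp E F). Qed.

Lemma definableU m n (X Y : vrel m n) :
  definable X -> definable Y -> definable (X `|` Y).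
Proof. by move=> [E ->] [F ->]; exists (EUnion E F). Qed.

Lemma definable_star m (X : vrel m m) : definable X -> definable (vrel_star X).
Proof. by move=> [E ->]; exists (EStar E). Qed.

(** Without edges, a section between equal states just equates the two padded vectors, and a section
    between the two distinct states is empty. *)
Definition idle_pvass d : pvass d :=
  @PVASS d bool void (fun=> false) (fun=> false) (fun=> 0) (fun=> ord0).

Lemma idle_reach d (c c' : config (idle_pvass d)) : reach c c' <-> c = c'.
Proof.
split=> [|->]; last exact: rt_refl.
by elim=> [x y [[]]||x y z _ -> _ ->].
Qed.

(** Supplies the identity, the insertion and removal of constant counters, and the two halves of a
    zero test. *)
Lemma definable_pad m n d (lemd : (m <= d)%N) (lend : (n <= d)%N)
    (b : 'rV[nat]_(d - m)) (c : 'rV[nat]_(d - n)) :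
  definable [set xy | pad lemd b xy.1 = pad lend c xy.2].
Proof.
apply: definable_vass; exists d, (idle_pvass d), lemd, lend, false, false, b, c.
split=> [[]|]; apply: vrel_ext => x y.
rewrite /section_of /=; split=> [->|/idle_reach []//]; exact: rt_refl.
Qed.

Lemma definable0 m n : definable (set0 : vrel m n).
Proof.
apply: definable_vass; exists (m + n)%N, (idle_pvass (m + n)).
exists (leq_addr n m), (leq_addl m n), false, true, 0, 0.
by split=> [[]|]; apply: vrel_ext => x y; split=> // /idle_reach [].
Qed.

Definition one_edge_pvass d (f : 'rV[int]_d) : pvass d :=
  @PVASS d bool unit (fun=> false) (fun=> true) (fun=> f) (fun=> ord0).

Lemma one_edge_reach d (f : 'rV[int]_d) x y :
  reach ((false, x) : config (one_edge_pvass f)) (true, y) <->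
  map_mx Posz y = map_mx Posz x + f.
Proof.
split=> [|fxy]; last by apply: rt_step; exists tt; split.
(* Invariant: the vector is still [x] at [false] and is [x + f] at [true]. It is preserved because
   the only edge leaves [false], so it fires from [x]. *)
pose I (c : bool * 'rV[nat]_d) :=
  if c.1 then map_mx Posz c.2 = map_mx Posz x + f else c.2 = x.
suff H c c' : reach (V := one_edge_pvass f) c c' -> I c -> I c'.
  by move=> fxy; apply: (H (false, x) (true, y)).
by elim=> {c c'} [[? u] [? v] [[] [/= -> -> _ fuv]]|//|c c1 c' _ I1 _ I2 /I1/I2 //];
  rewrite /I /= => <-.
Qed.

Lemma definable_effect d (f : 'rV[int]_d) :
  definable [set xy | map_mx Posz xy.2 = map_mx Posz xy.1 + f].
Proof.
apply: definable_vass; exists d, (one_edge_pvass f), (leqnn d), (leqnn d).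
exists false, true, 0, 0; split=> // ; apply: vrel_ext => x y.
by rewrite /section_of /= !pad_id; split=> /one_edge_reach.
Qed.

Lemma definable_bigU m n (T : finType) (P : pred T) (X : T -> vrel m n) :
  (forall t, definable (X t)) ->
  definable [set xy | exists2 t, P t & X t xy].
Proof.
move=> dX; suff dXs (s : seq T) : definable [set xy | exists2 t, (t \in s) && P t & X t xy].
  have := dXs (enum T); congr definable; apply: vrel_ext => x y.
  by split=> -[t]; [case/andP|]; exists t; rewrite // ?mem_enum.
elim: s => [|t s IHs].
  by have := definable0 m n; congr definable; apply: vrel_ext => x y; split=> // -[].
case: (boolP (P t)) => Pt.
  have := definableU (dX t) IHs; congr definable; apply: vrel_ext => x y; split.
    case=> [Xt|[u /andP[us Pu] Xu]]; first by exists t; rewrite ?mem_head.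
    by exists u => //; rewrite inE us orbT.
  move=> [u /andP[]]; rewrite inE => /orP[/eqP->|us] Pu Xu; first by left.
  by right; exists u => //; rewrite us.
have := IHs; congr definable; apply: vrel_ext => x y; split=> -[u /andP[us Pu] Xu].
  by exists u; rewrite // inE us orbT.
exists u => //; move: us; rewrite inE Pu andbT => /orP[/eqP ut|//].
by rewrite -ut Pu in Pt.
Qed.

(** * Kleene's algorithm over relations on N^d *)

Section Kleene.
Variables (d : nat) (T : finType) (A : T -> T -> vrel d d).

Definition path_step (c c' : T * 'rV[nat]_d) := A c.1 c'.1 (c.2, c'.2).

Definition vid : vrel d d := [set xy | xy.1 = xy.2].

(* Paths all of whose intermediate nodes lie in [l], built by McNaughton and
   Yamada's recursion. *)
Fixpoint kleene (l : seq T) (s t : T) : vrel d d :=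
  if l is a :: l' then
    kleene l' s t `|`
    (kleene l' a t \; (vrel_star (kleene l' a a) \; kleene l' s a))%relation
  else A s t `|` (if s == t then vid else set0).

Lemma kleene_definable l s t :
  (forall s t, definable (A s t)) -> definable (kleene l s t).
Proof.
move=> dA; elim: l s t => [|a l IHl] s t /=.
  apply: definableU => //; case: eqP => _; last exact: definable0.
  have := definable_pad (leqnn d) (leqnn d) 0 0.
  by congr definable; apply: vrel_ext => x y; rewrite /vid /= !pad_id.
apply: definableU => //; have dstar := definable_star (IHl a a).
exact: definable_comp (definable_comp (IHl s a) dstar) (IHl a t).
Qed.

Lemma kleene_sound l s t x y :
  kleene l s t (x, y) -> clos_refl_trans _ path_step (s, x) (t, y).
Proof.
elim: l s t x y => [|a l IHl] s t x y /=.
  case=> [Ast|]; first exact: rt_step.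
  by case: eqP => // -> xy; rewrite (xy : x = y); apply: rt_refl.
case=> [/IHl//|[z [w /IHl sa /= aa] /IHl ta]].
apply: rt_trans sa _; apply: rt_trans ta.
have {}aa : clos_refl_trans _ (fun v v' => kleene l a a (v, v')) w z := aa.
elim: aa => {w z} [w z /IHl //|w|w v z _ + _]; first exact: rt_refl.
exact: rt_trans.
Qed.

Lemma kleene_step l s t x y : A s t (x, y) -> kleene l s t (x, y).
Proof. by elim: l => [|a l IHl] /= Ast; left=> //; apply: IHl. Qed.

Lemma kleene_refl l s x : kleene l s s (x, x).
Proof. by elim: l => [|a l IHl] /=; [right; rewrite eqxx|left]. Qed.

(** The meeting node becomes intermediate, hence must lie in [l]. If it is the head, each half
    splits there into a part over the tail and a series of loops, and the two series concatenate.
    Otherwise the pieces next to it are joined by the induction hypothesis. *)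
Lemma kleene_trans l a s t x y z : a \in l ->
  kleene l s a (x, y) -> kleene l a t (y, z) -> kleene l s t (x, z).
Proof.
elim: l a s t x y z => [//|b l IHl] a s t x y z.
rewrite inE => /orP[/eqP {a}->|al] /=.
  move=> sb bt; right.
  have {sb} [v sv vy] : exists2 v, kleene l s b (x, v) &
      vrel_star (kleene l b b) (v, y).
    case: sb => [sb|[w [v sv vw] wy]]; first by exists y => //; apply: rt_refl.
    by exists v => //; apply: rt_trans vw _; apply: rt_step.
  have {bt} [w yw wz] : exists2 w, vrel_star (kleene l b b) (y, w) &
      kleene l b t (w, z).
    case: bt => [bt|[w [u yu uw] wz]]; first by exists y => //; apply: rt_refl.
    by exists w => //; apply: rt_trans uw; apply: rt_step.
  by exists w => //; exists v => //; apply: rt_trans vy yw.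
have tr := IHl a _ _ _ _ _ al.
case=> [sa|[u [v sv vu] ua]] [at_|[u' [v' av' vu'] ut]].
- by left; apply: tr sa at_.
- by right; exists u' => //; exists v' => //; apply: tr sa av'.
- by right; exists u => /=; [exists v|apply: tr ua at_].
(* Both halves visit [b]: the stretch from the last such visit in the first half, through [a], to
   the first one in the second half is one more loop at [b]. *)
- right; exists u' => //; exists v => //; apply: rt_trans vu _.
  by apply: rt_trans vu'; apply: rt_step; apply: tr ua av'.
Qed.

Lemma kleeneP s t x y :
  kleene (enum T) s t (x, y) <-> clos_refl_trans _ path_step (s, x) (t, y).
Proof.
split=> [|st]; first exact: kleene_sound.
suff H c c' : clos_refl_trans _ path_step c c' ->
  kleene (enum T) c.1 c'.1 (c.2, c'.2) by apply: (H (s, x) (t, y)).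
elim=> {st c c'} [c c'|c|c [a z] c' _ IH1 _ IH2]; first exact: kleene_step.
  exact: kleene_refl.
by apply: kleene_trans IH1 IH2; rewrite mem_enum.
Qed.

End Kleene.

(** * From PVASS sections to expressions *)

Lemma pvass_section_definable m n (X : vrel m n) :
  pvass_section X -> definable X.
Proof.
move=> [d [V [lemd [lend [p [q [bs [bt ->]]]]]]]].
pose tst (e : edge V) : vrel d d :=
  [set xy | xy.1 = xy.2 /\ zeros (prio e) xy.1].
have dtst e : definable (tst e).
  (* Since [prio e <= d], padding from dimension [d - prio e] up to [d] inserts exactly [prio e]
     zeros. *)
  have led : (d - prio e <= d)%N by apply: leq_subr.
  have := definable_comp (definable_pad (leqnn d) led 0 0)
                         (definable_pad led (leqnn d) 0 0).
  congr definable; apply: vrel_ext => x y; rewrite /tst /=; split.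
    move=> [z]; rewrite !pad_id => -> <-; split=> // j ltj.
    apply: pad0_zeros; rewrite subKn //; by rewrite -ltnS.
  case=> <- zx; have [z ->] : exists z, x = pad led 0 z.
    by apply: zeros_pad0 => j; rewrite subKn; [apply: zx|rewrite -ltnS].
  by exists z; rewrite !pad_id.
pose A s t : vrel d d := [set xy | exists2 e : edge V,
  (src e == s) && (tgt e == t) &
  ([set xy | map_mx Posz xy.2 = map_mx Posz xy.1 + effect e] \; tst e)%relation xy].
have dA s t : definable (A s t).
  by apply: definable_bigU => e; apply: definable_comp => //; apply: definable_effect.
have AE : path_step A =2 @step d V.
  move=> [s x] [t y]; apply/propext; split.
    by move=> [e /andP[/eqP se /eqP te] /= [z [/= <- zx] fe]]; exists e; split.
  move=> [e [/= -> -> zx fe]]; exists e; first by rewrite !eqxx.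
  by exists x.
(* Insert the constants [bs], follow the paths from [p] to [q] with all states allowed as
   intermediate nodes, then remove the constants [bt]. *)
have := definable_comp (definable_comp (definable_pad lemd (leqnn d) bs 0)
  (kleene_definable (enum (state V)) p q dA)) (definable_pad (leqnn d) lend 0 bt).
congr definable; apply: vrel_ext => x y; rewrite /section_of /reach /=.
have -> : @step d V = path_step A by apply/funext=> c; apply/funext=> c'; rewrite AE.
split; first by move=> [z [w]] /=; rewrite !pad_id => <- /kleeneP r <-.
by move=> /kleeneP r; exists (pad lend bt y); rewrite ?pad_id //=;
  exists (pad lemd bs x); rewrite ?pad_id.
Qed.

(** * Graphs whose edges are PVASS *)

Section Glue.

(* The first [g a] counters vanish at node [a]; edge [i] of the graph runs
   [V i] from [p i] to [q i], with [u i] added on entry and [w i] removed on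
   exit. The exit edge cannot test its target, since tests come before effects;
   the next entry edge does. *)
Variables (d : nat) (N I : finType) (g : N -> 'I_d.+1) (s t : I -> N).
Variables (V : I -> pvass d) (p q : forall i, state (V i)).
Variables (u w : I -> 'rV[nat]_d).

(** The edges are those inside the copies ([inl]), one entry edge per index ([inr (inl i)]) and one
    exit edge per index ([inr (inr i)]); the states are the nodes of the graph ([inl]) and the
    states of the copies ([inr]). *)
Definition glue_src (e : {i : I & edge (V i)} + (I + I)) :
    N + {i : I & state (V i)} :=
  match e with
  | inl e => inr (Tagged (fun i => state (V i)) (src (tagged e)))
  | inr (inl i) => inl (s i)
  | inr (inr i) => inr (Tagged (fun i => state (V i)) (q i))
  end.

Definition glue_tgt (e : {i : I & edge (V i)} + (I + I)) :
    N + {i : I & state (V i)} :=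
  match e with
  | inl e => inr (Tagged (fun i => state (V i)) (tgt (tagged e)))
  | inr (inl i) => inr (Tagged (fun i => state (V i)) (p i))
  | inr (inr i) => inl (t i)
  end.

Definition glue_effect (e : {i : I & edge (V i)} + (I + I)) : 'rV[int]_d :=
  match e with
  | inl e => effect (tagged e)
  | inr (inl i) => map_mx Posz (u i)
  | inr (inr i) => - map_mx Posz (w i)
  end.

Definition glue_prio (e : {i : I & edge (V i)} + (I + I)) : 'I_d.+1 :=
  match e with
  | inl e => prio (tagged e)
  | inr (inl i) => g (s i)
  | inr (inr i) => ord0
  end.

Definition glue := PVASS glue_src glue_tgt glue_effect glue_prio.

(** A full traversal of edge [i] as seen from the nodes: the vectors are those before entry and
    after exit. *)
Definition glue_step (c c' : N * 'rV[nat]_d) := exists i : I,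
  [/\ c.1 = s i, c'.1 = t i, zeros (g (s i)) c.2 &
      reach (p i, c.2 + u i) (q i, c'.2 + w i)].

Lemma glue_inner i (c c' : config (V i)) : reach c c' ->
  reach (V := glue) (inr (Tagged (fun i => state (V i)) c.1), c.2)
                    (inr (Tagged (fun i => state (V i)) c'.1), c'.2).
Proof.
elim=> {c c'} [c c' [e [cs ct z f]]|c|c c1 c' _ + _]; last 2 first.
- exact: rt_refl.
- exact: rt_trans.
apply: rt_step; exists (inl (Tagged (fun i => edge (V i)) e)).
by split=> //=; rewrite ?cs ?ct.
Qed.

Lemma glue_reach a x b y :
  reach (V := glue) (inl a, x) (inl b, y) <->
  clos_refl_trans _ glue_step (a, x) (b, y).
Proof.
split; last first.
  suff H c c' : clos_refl_trans _ glue_step c c' ->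
      reach (V := glue) (inl c.1, c.2) (inl c'.1, c'.2).
    by apply: (H (a, x) (b, y)).
  elim=> {c c'} [c c' [i [cs ct z r]]|c|c c1 c' _ + _]; last 2 first.
  - exact: rt_refl.
  - exact: rt_trans.
  apply: (rt_trans _ _ _ (inr (Tagged (fun i => state (V i)) (p i)), c.2 + u i)).
    apply: rt_step; exists (inr (inl i)); split=> //=; first by rewrite cs.
    by rewrite map_PoszD.
  apply: rt_trans (glue_inner r) _; apply: rt_step; exists (inr (inr i)).
  by split=> //=; rewrite ?ct // map_PoszD addrK.
(* At a node, the run so far is a sequence of full traversals. Inside a copy, it is such a sequence
   followed by a tested entry with some vector [z] and a partial run of the copy. *)
pose inv (c : config glue) := match c.1 with
  | inl b => clos_refl_trans _ glue_step (a, x) (b, c.2)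
  | inr r => exists z, [/\ clos_refl_trans _ glue_step (a, x) (s (tag r), z),
      zeros (g (s (tag r))) z &
      reach (p (tag r), z + u (tag r)) (tagged r, c.2)] end.
move=> /clos_rt_rtn1_iff r; change (inv (inl b, y)).
elim: r => [|[c1 c2] [c1' c2'] [e [/= -> -> ze fe]] _]; first exact: rt_refl.
case: e ze fe => [e|[i|i]] /= ze fe; rewrite /inv /=.
- case=> z [az zz r]; exists z; split=> //.
  by apply: reach_step r _; exists (tagged e).
- move=> ac; exists c2; split=> //.
  have -> : c2' = c2 + u i by apply: map_Posz_inj; rewrite map_PoszD.
  exact: rt_refl.
- case=> z [az zz r]; apply: rt_trans az _; apply: rt_step.
  exists i; split=> //=; have -> // : c2' + w i = c2.
  by apply: map_Posz_inj; rewrite map_PoszD fe addrNK.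
Qed.

End Glue.

(** * Lifting sections to a common dimension *)

Lemma clos_rt_inv (A : Type) (R : A -> A -> Prop) x z :
  clos_refl_trans A R x z ->
  x = z \/ exists2 y, R x y & clos_refl_trans A R y z.
Proof.
by move=> /clos_rt_rt1n_iff[|y z' xy /clos_rt_rt1n_iff]; [left|right; exists y].
Qed.

(** The dimension is a parameter here, so that two sections can be required to share it. *)
Definition section_at d m n (X : vrel m n) :=
  exists (V : pvass d) (lemd : (m <= d)%N) (lend : (n <= d)%N) (p q : state V)
         (bs : 'rV[nat]_(d - m)) (bt : 'rV[nat]_(d - n)),
    X = section_of lemd lend p q bs bt.

(** Separates the encoding [(0, x)] kept at the nodes of a glued graph from the constants [(b, 0)],
    which entry edges add and exit edges remove. *)
Lemma padD0 m d (lemd : (m <= d)%N) b x :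
  pad lemd b x = pad lemd 0 x + pad lemd b 0.
Proof.
apply/rowP=> j; pose k := cast_ord (esym (subnK lemd)) j.
rewrite mxE !(@pad_entry _ _ _ _ _ j k) //.
by case: (split_ordP k) => i ->; rewrite ?row_mxEl ?row_mxEr !mxE ?add0r ?addr0.
Qed.

Lemma pad_inj m d (lemd : (m <= d)%N) b : injective (pad lemd b).
Proof.
move=> x y /rowP xy; apply/rowP=> j.
have := xy (cast_ord (subnK lemd) (rshift _ j)).
by rewrite !(@pad_entry _ _ _ _ _ _ (rshift _ j)) // !row_mxEr.
Qed.

Lemma section_of_pad0 d m n (lemd : (m <= d)%N) (lend : (n <= d)%N)
    (V : pvass d) (p q : state V) bs bt x y :
  section_of lemd lend p q bs bt (x, y) <->
  reach (p, pad lemd 0 x + pad lemd bs 0) (q, pad lend 0 y + pad lend bt 0).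
Proof. by rewrite /section_of /= (padD0 lemd bs) (padD0 lend bt). Qed.

(** The priority whose test recognises the vectors of N^d that encode vectors of N^m. *)
Definition codim m d : 'I_d.+1 := Ordinal (leq_subr m d : (d - m < d.+1)%N).

Section Lift.
Variables (k d : nat) (V : pvass d).

Lemma lift_prio_subproof (e : edge V) : (k + prio e < (k + d).+1)%N.
Proof. by rewrite ltnS leq_add2l -ltnS. Qed.

(** The new counters come first, so testing the first [prio e] old counters means testing
    [k + prio e] counters. Every edge thus tests the new counters as well, which is harmless as they
    stay 0. *)
Definition lift_pvass : pvass (k + d) :=
  PVASS (@src _ V) (@tgt _ V) (fun e => row_mx 0 (effect e))
        (fun e => Ordinal (lift_prio_subproof e)).

Lemma lift_effect (x y : 'rV[nat]_d) (f : 'rV[int]_d) (y0 : 'rV[nat]_k) :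
  map_mx Posz (row_mx y0 y) = map_mx Posz (row_mx 0 x) + row_mx 0 f <->
  y0 = 0 /\ map_mx Posz y = map_mx Posz x + f.
Proof.
rewrite !map_row_mx add_row_mx addr0; split=> [/eq_row_mx[y0E ->]|[-> ->]] //.
by split=> //; apply: map_Posz_inj.
Qed.

Lemma lift_step p x q (y' : 'rV[nat]_(k + d)) :
  step (V := lift_pvass) (p, row_mx 0 x) (q, y') <->
  exists2 y, y' = row_mx 0 y & step (V := V) (p, x) (q, y).
Proof.
split.
  move=> [e [/= -> -> ze]]; rewrite -(hsubmxK y') => /lift_effect[-> f].
  exists (rsubmx y') => //; exists e; split=> //= j ltj.
  by have := ze (rshift k j); rewrite /= ltn_add2l row_mxEr; apply.
move=> [y -> [e [/= -> -> ze f]]]; exists e; split=> //=; last exact/lift_effect.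
move=> j; case: (split_ordP j) => i ->; rewrite ?row_mxEl ?row_mxEr ?mxE //=.
by rewrite ltn_add2l; apply: ze.
Qed.

Lemma lift_reach p x q y :
  reach (V := lift_pvass) (p, row_mx 0 x) (q, row_mx 0 y) <->
  reach (V := V) (p, x) (q, y).
Proof.
split.
  suff H c : reach (V := lift_pvass) (p, row_mx 0 x) c ->
      exists2 z, c.2 = row_mx 0 z & reach (V := V) (p, x) (c.1, z).
    by move=> /H[z /= /eq_row_mx[_ ->]].
  move=> /clos_rt_rtn1_iff; elim=> {c} [|[c x1] [c' x2] + _ [z /= zE r]].
    by exists x => //; apply: rt_refl.
  rewrite zE => /lift_step[v -> st]; exists v => //; exact: reach_step r st.
suff H c c' : reach (V := V) c c' ->
    reach (V := lift_pvass) (c.1, row_mx 0 c.2) (c'.1, row_mx 0 c'.2).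
  exact: (H (p, x) (q, y)).
elim=> {c c'} [[p1 x1] [q1 y1] st|c|c c1 c' _ + _]; last 2 first.
- exact: rt_refl.
- exact: rt_trans.
by apply: rt_step; apply/lift_step; exists y1.
Qed.

(** Concatenation is associative: the new constants are [(0, b)], cast along
    [k + (d - m) = k + d - m]. *)
Lemma lift_pad m (lemd : (m <= d)%N) (lemkd : (m <= k + d)%N) b :
  exists b', forall x, pad lemkd b' x = row_mx 0 (pad lemd b x).
Proof.
exists (castmx (erefl 1%N, addnBA k lemd) (row_mx 0 b)) => x.
apply/rowP=> j; pose j' := cast_ord (esym (subnK lemkd)) j.
rewrite (@pad_entry _ _ _ _ _ j j') //.
(* Three blocks of coordinates: the [k] new zeros, the [d - m] entries of [b], the [m] entries of
   [x]. *)
case: (split_ordP j') => i iE; have /= ji := congr1 val iE; rewrite iE.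
  rewrite row_mxEl castmxE ord1; pose i' := cast_ord (esym (addnBA k lemd)) i.
  case: (split_ordP i') => h hE; have /= ih := congr1 val hE;
    rewrite -/i' hE.
    rewrite row_mxEl; have -> : j = lshift d h by apply: val_inj; rewrite /= ji ih.
    by rewrite row_mxEl !mxE.
  have ltd : (h < d)%N by apply: leq_trans (ltn_ord h) (leq_subr _ _).
  have -> : j = rshift k (Ordinal ltd) by apply: val_inj; rewrite /= ji ih.
  by rewrite !row_mxEr (@pad_entry _ _ _ _ _ _ (lshift m h)) // row_mxEl.
have ltd : (d - m + i < d)%N by rewrite -[ltnRHS](subnK lemd) ltn_add2l.
have -> : j = rshift k (Ordinal ltd).
  by apply: val_inj; rewrite /= ji addnA addnBA.
by rewrite !row_mxEr (@pad_entry _ _ _ _ _ _ (rshift _ i)) // row_mxEr.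
Qed.

End Lift.

Lemma section_at_leq d D m n (X : vrel m n) :
  (d <= D)%N -> section_at d X -> section_at D X.
Proof.
move=> /subnK <-; set k := (D - d)%N; move=> [V [lemd [lend [p [q [bs [bt ->]]]]]]].
have leK i : (i <= d)%N -> (i <= k + d)%N by move=> /leq_trans; apply; apply: leq_addl.
exists (lift_pvass k V), (leK m lemd), (leK n lend), p, q.
have [bs' bs'E] := lift_pad lemd (leK m lemd) bs.
have [bt' bt'E] := lift_pad lend (leK n lend) bt.
exists bs', bt'; apply: vrel_ext => x y; rewrite /section_of /= bs'E bt'E.
by split=> /lift_reach.
Qed.

Lemma section_at2 m n k l (X : vrel m n) (Y : vrel k l) :
  pvass_section X -> pvass_section Y ->
  exists d, section_at d X /\ section_at d Y.
Proof.
move=> [d1 sX] [d2 sY]; exists (maxn d1 d2).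
by split; [apply: section_at_leq sX|apply: section_at_leq sY]; rewrite leq_max leqnn ?orbT.
Qed.

(** * Closure of PVASS sections under star, union and composition *)

Lemma glue_section d m n (lemd : (m <= d)%N) (lend : (n <= d)%N) (N I : finType)
    (g : N -> 'I_d.+1) (s t : I -> N) (V : I -> pvass d)
    (p q : forall i, state (V i)) (u w : I -> 'rV[nat]_d) a b :
  pvass_section ([set xy | clos_refl_trans _ (glue_step g s t p q u w)
     (a, pad lemd 0 xy.1) (b, pad lend 0 xy.2)] : vrel m n).
Proof.
exists d, (glue g s t p q u w), lemd, lend, (inl a), (inl b), 0, 0.
by apply: vrel_ext => x y; rewrite /section_of /=; split=> /glue_reach.
Qed.

(** The graph is a single node with one loop, whose guard forces every traversal to start from an
    encoded vector of N^m. *)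
Lemma pvass_section_star m (X : vrel m m) :
  pvass_section X -> pvass_section (vrel_star X).
Proof.
move=> [d [V [lemd [lemd' [p [q [bs [bt ->]]]]]]]].
rewrite (bool_irrelevance lemd' lemd) => {lemd'}.
set S := section_of _ _ _ _ _ _.
have := @glue_section d m m lemd lemd unit unit (fun=> codim m d) id id
  (fun=> V) (fun=> p) (fun=> q) (fun=> pad lemd bs 0) (fun=> pad lemd bt 0) tt tt.
congr pvass_section; apply: vrel_ext => x y; rewrite /vrel_star /=; split; last first.
  elim=> {x y} [x y /section_of_pad0 Sxy|x|x y z _ + _]; last 2 first.
  - exact: rt_refl.
  - exact: rt_trans.
  by apply: rt_step; exists tt; split=> //=; apply: pad0_zeros.
set gs := glue_step _ _ _ _ _ _ _.
suff H c : clos_refl_trans _ gs c (tt, pad lemd 0 y) ->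
    forall x, c.2 = pad lemd 0 x ->
    clos_refl_trans _ (fun x y => S (x, y)) x y by move=> /H; apply.
move=> /clos_rt_rt1n_iff r; set c' := (tt, _) in r.
have: c' = (tt, pad lemd 0 y) by []; elim: r => {c c'} [c ->|c c1 c' gcc1 r IH c'E] z /=.
  by move=> /pad_inj ->; apply: rt_refl.
case: gcc1 => i [_ _ _ rcc1] cE.
(* The vector after a traversal encodes one of N^m, although the exit edge does not test it: it
   either ends the run or passes the guard of the next traversal. *)
have [v c1E] : exists v, c1.2 = pad lemd 0 v.
  case: r c'E => [->|c2 c3 [j [_ _ zc1 _]] _ _]; first by exists y.
  exact: zeros_pad0.
apply: rt_trans (IH c'E v c1E); apply: rt_step.
by apply/section_of_pad0; rewrite -cE -c1E.
Qed.

(** The graph has two parallel edges from [false] to [true]. No edge leaves [true], so a run between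
    them traverses exactly one edge. *)
Lemma pvass_sectionU m n (X Y : vrel m n) :
  pvass_section X -> pvass_section Y -> pvass_section (X `|` Y).
Proof.
move=> /section_at2/[apply] -[d []].
move=> [V1 [lemd [lend [p1 [q1 [bs1 [bt1 ->]]]]]]].
move=> [V2 [lemd' [lend' [p2 [q2 [bs2 [bt2 ->]]]]]]].
rewrite (bool_irrelevance lemd' lemd) (bool_irrelevance lend' lend) {lemd' lend'}.
set X1 := section_of _ _ _ _ _ _; set X2 := section_of _ _ _ _ _ _.
have := @glue_section d m n lemd lend bool bool (fun=> codim m d)
  (fun=> false) (fun=> true) (fun i => if i then V1 else V2)
  (fun i => if i return state (if i then V1 else V2) then p1 else p2)
  (fun i => if i return state (if i then V1 else V2) then q1 else q2)
  (fun i => pad lemd (if i then bs1 else bs2) 0)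
  (fun i => pad lend (if i then bt1 else bt2) 0) false true.
congr pvass_section; apply: vrel_ext => x y; split=> /=; last first.
  by case=> /section_of_pad0 r; apply: rt_step; [exists true|exists false];
    split=> //; apply: pad0_zeros.
move=> r; case: (clos_rt_inv r) => {r} [//|[[a z] [i [_ /= -> _ ri]] r]].
case: (clos_rt_inv r) => {r} [[zE]|[? [j [//]]]].
by rewrite zE in ri; case: i ri => ri; [left|right]; apply/section_of_pad0.
Qed.

(** The graph is the path [None], [Some true], [Some false], with [V1] on its first edge and [V2] on
    its second. *)
Lemma pvass_section_comp m n k (X : vrel m n) (Y : vrel n k) :
  pvass_section X -> pvass_section Y -> pvass_section (Y \; X)%relation.
Proof.
move=> /section_at2/[apply] -[d []].
move=> [V1 [lemd [lend [p1 [q1 [bs1 [bt1 ->]]]]]]].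
move=> [V2 [lend' [lekd [p2 [q2 [bs2 [bt2 ->]]]]]]].
rewrite (bool_irrelevance lend' lend) {lend'}.
set X1 := section_of _ _ _ _ _ _; set X2 := section_of _ _ _ _ _ _.
have := @glue_section d m k lemd lekd (option bool) bool
  (fun a => if a is None then codim m d else codim n d)
  (fun i => if i then None else Some true) (fun i => Some i)
  (fun i => if i then V1 else V2)
  (fun i => if i return state (if i then V1 else V2) then p1 else p2)
  (fun i => if i return state (if i then V1 else V2) then q1 else q2)
  (fun i => if i then pad lemd bs1 0 else pad lend bs2 0)
  (fun i => if i then pad lend bt1 0 else pad lekd bt2 0) None (Some false).
congr pvass_section; apply: vrel_ext => x y; split=> /=; last first.
  move=> [z /section_of_pad0 r1 /section_of_pad0 r2].
  apply: (rt_trans _ _ _ (Some true, pad lend 0 z)); apply: rt_step.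
    by exists true; split=> //; apply: pad0_zeros.
  by exists false; split=> //; apply: pad0_zeros.
move=> r; case: (clos_rt_inv r) => {r} [//|[[a1 z] [[] [//= _ -> _ r1]] r]].
case: (clos_rt_inv r) => {r} [//|[[a2 z2] [[] [//= _ -> zz r2]] r]].
case: (clos_rt_inv r) => {r} [[zE]|[? [[] [//]]]]; rewrite zE in r2.
(* The guard at the middle node makes the intermediate vector an encoding of some [v] in N^n, the
   vector that composition asks for. *)
have [v vE] := @zeros_pad0 _ _ lend _ zz; rewrite vE in r1 r2.
by exists v; apply/section_of_pad0.
Qed.

Lemma vass_section_pvass m n (X : vrel m n) : vass_section X -> pvass_section X.
Proof.
move=> [d [V [lemd [lend [p [q [bs [bt [_ XE]]]]]]]]].
by exists d, V, lemd, lend, p, q, bs, bt.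
Qed.

Theorem theorem7 (d' d'' : nat) (X : vrel d' d'') :
  pvass_section X <-> exists E : expr d' d'', X = Rel E.
Proof.
split=> [|[E ->]]; first exact: pvass_section_definable.
elim: {d' d'' X} E
  => [m n Y /vass_section_pvass|m n k E IHE F IHF|m n E IHE F IHF|m E IHE] //=.
- exact: pvass_section_comp.
- exact: pvass_sectionU.
- exact: pvass_section_star.
Qed.
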